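(* Let $n\ge 4$. The mapping $\mathcal{C}\longmapsto(\mathcal{C}',b_{\mathcal{C}})$ defines a bijection between the set of collections $\mathcal{C}\in \mathrm{W}(3,n)$ containing $\{1,n-2,n-1\}$ and the set $$\Big\{(\mathcal{B},b)\in \mathrm{W}(3,n-1)\times[2\dots n-2]\ :\ b\in F_{\mathcal{B}}\Big\}.$$ The inverse bijection sends a pair $(\mathcal{B},b)$ to the collection $$\hat{\mathcal{B}}_b:=\{I_b: I\in\mathcal{B}\}\sqcup\Big\{\{1,b,n-1\},\{1,n-1,n\},\{n-2,n-1,n\}\Big\},$$ where $$I_b=\begin{cases}(I-\{n-1\})\sqcup\{n\} & \text{if } n-1\in I \text{ and } I-\{1,b,n-1\}\prec\{1,b\}-I,\\ I & \text{otherwise.}\end{cases}$$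
   Context: Notation: $[a\dots b]=\{a,\dots,b\}$; $X-Y$ is set difference. For sets of integers write $X\prec Y$ if $x<y$ for all $x\in X$, $y\in Y$ (vacuously true if one is empty). Two $k$-subsets $I,J$ of $[1\dots n]$ are weakly separated if at least one of the following holds: (1) $J-I$ can be partitioned as $J'\sqcup J''$ with $J'\prec I-J\prec J''$; (2) $I-J$ can be partitioned as $I'\sqcup I''$ with $I'\prec J-I\prec I''$. (Parts may be empty.) $\mathrm{W}(k,n)$ is the set of all maximal (by inclusion) collections of pairwise weakly separated $k$-subsets of $[1\dots n]$. For a $3$-subset $I$ of $[1\dots n]$ put $I'=(I\sqcup\{n-1\})-\{n\}$ if $n\in I$ and $n-1\notin I$; $I'=\emptyset$ if $n\in I$ and $n-1\in I$; and $I'=I$ if $n\notin I$. For $\mathcal{C}\in \mathrm{W}(3,n)$ let $\mathcal{C}'=\{I': I\in\mathcal{C}\}$, with the empty set discarded. For $\mathcal{C}\in \mathrm{W}(3,n)$ containing $\{1,n-2,n-1\}$, $b_{\mathcal{C}}$ denotes the unique index $b>1$ such that both $\{1,b,n-1\}$ and $\{1,b,n\}$ are ($3$-element sets) in $\mathcal{C}$ (such an index exists and is unique). For any $N$ and any $\mathcal{B}\in \mathrm{W}(3,N)$, $F_{\mathcal{B}}$ is the set of indices $b\in[2\dots N-1]$ with $\{1,b,N\}\in\mathcal{B}$ such that $\{1,b\}-\{s,t\}\prec\{s,t\}-\{1,b\}$ whenever $\{s,t,N\}\in\mathcal{B}$ with $1<s<t<N$. (In the theorem this is used with $N=n-1$.)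 *)

(* Defs.v *)
(* Indices are 1-based natural numbers, so that the subsets of [1..n-1] are
   literally subsets of [1..n] and no casts between index types occur. *)
From mathcomp Require Import all_boot finmap.
From mathcomp Require Export boolp classical_sets functions.

Set Implicit Arguments.
Unset Strict Implicit.
Unset Printing Implicit Defensive.

Local Open Scope classical_set_scope.
Local Open Scope fset_scope.
Local Open Scope nat_scope.

Notation collection := {fset {fset nat}}.

Definition interval (a b : nat) : {fset nat} := [fset i in index_iota a b.+1].

Definition prec (X Y : {fset nat}) : bool := allrel ltn X Y.

Definition ksubset (k n : nat) (I : {fset nat}) : bool :=
  (I `<=` interval 1 n) && (#|` I| == k).

Definition surrounds (J I : {fset nat}) : Prop :=
  exists J1 J2 : {fset nat},
    [/\ J `\` I = J1 `|` J2, [disjoint J1 & J2],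
        prec J1 (I `\` J) & prec (I `\` J) J2].

Definition weakly_separated (I J : {fset nat}) : Prop :=
  surrounds J I \/ surrounds I J.

Definition ws_collection (k n : nat) (C : collection) : Prop :=
  (forall I, I \in C -> ksubset k n I) /\
  (forall I J, I \in C -> J \in C -> weakly_separated I J).

Definition W (k n : nat) : set collection :=
  [set C | ws_collection k n C /\
    forall D, ws_collection k n D -> C `<=` D -> D = C].

(* The empty set encodes "I is discarded". *)
Definition merge_last (n : nat) (I : {fset nat}) : {fset nat} :=
  if n \in I then
    if n - 1 \in I then fset0 else (n - 1) |` (I `\ n)
  else I.

Definition merge_coll (n : nat) (C : collection) : collection :=
  [fset merge_last n I | I in C] `\ fset0.

Definition is_b_index (n : nat) (C : collection) (b : nat) : Prop :=
  [/\ 1 < b, [fset 1; b; n - 1] \in C & [fset 1; b; n] \in C].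

(* Definite description: [0] is a junk value, used only if no index satisfies
   [is_b_index n C]. *)
Definition b_index (n : nat) (C : collection) : nat :=
  xget 0 [set b | is_b_index n C b].

Definition F (N : nat) (B : collection) : set nat :=
  [set b | [/\ b \in interval 2 (N - 1), [fset 1; b; N] \in B &
    forall s t, 1 < s -> s < t -> t < N -> [fset s; t; N] \in B ->
      prec ([fset 1; b] `\` [fset s; t]) ([fset s; t] `\` [fset 1; b])]].

Definition domC (n : nat) : set collection :=
  [set C | W 3 n C /\ [fset 1; n - 2; n - 1] \in C].

Definition codC (n : nat) : set (collection * nat) :=
  [set p | [/\ W 3 (n - 1) p.1, p.2 \in interval 2 (n - 2)
             & F (n - 1) p.1 p.2]].

Definition contract (n : nat) (C : collection) : collection * nat :=
  (merge_coll n C, b_index n C).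

Definition split_last (n b : nat) (I : {fset nat}) : {fset nat} :=
  if (n - 1 \in I) && prec (I `\` [fset 1; b; n - 1]) ([fset 1; b] `\` I)
  then n |` (I `\ (n - 1)) else I.

Definition split_coll (n : nat) (B : collection) (b : nat) : collection :=
  [fset split_last n b I | I in B].

Definition new_sets (n b : nat) : collection :=
  [fset [fset 1; b; n - 1]; [fset 1; n - 1; n]; [fset n - 2; n - 1; n]].

Definition expand (n : nat) (p : collection * nat) : collection :=
  split_coll n p.1 p.2 `|` new_sets n p.2.

(* Main.v *)
Require Import Defs.
From mathcomp Require Import all_boot finmap zify.

(* Write [m = n - 1].  Two sets are weakly separated iff no four elements
   [a < b < c < d] alternate between the two differences, so every claim about
   3-sets is a claim about alternations.
   Existence of [b]: if [d] is the largest index below [m] with {1,d,n} in C,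
   then {1,d,m} alternates with no member of C, because {1,d,n} and {1,n-2,m}
   do not; so maximality puts it in C.
   Given [b], the members of C containing [n] are {1,m,n}, {n-2,m,n} and sets
   {1,v,n} with [v <= b], and [split_last] only changes the sets {1,y,m} with
   [y <= b]; hence contraction and expansion are mutually inverse and preserve
   weak separation.  Maximality of an expansion follows by contracting a larger
   collection.  For the maximality of C' under D, one must rule out a set
   {s,t,m} in D with [1 < s < t < b], so that D can be expanded: taking [d]
   largest below [b] with {1,d,n} in C, the set {1,d,b} lies in C (again it
   alternates with no member of C), hence in D, and it alternates with
   {s,t,m}. *)

Set Implicit Arguments.
Unset Strict Implicit.
Unset Printing Implicit Defensive.

Local Open Scope fset_scope.
Local Open Scope nat_scope.

(** * Weak separation as the absence of alternations *)

Definition crosses (I J : {fset nat}) : Prop :=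
  exists a b c d, [/\ a < b, b < c, c < d & [/\ a \in I `\` J, b \in J `\` I,
    c \in I `\` J & d \in J `\` I]].

Lemma surroundsP (I J : {fset nat}) :
  surrounds J I <->
  forall i j k, i \in I `\` J -> j \in J `\` I -> k \in I `\` J ->
    i < j -> j < k -> False.
Proof.
split=> [[J1 [J2 [eqJ _ /allrelP lt1 /allrelP lt2]]] i j k Ii Jj Ik ij jk|H].
  move: Jj; rewrite eqJ inE => /orP[Jj|Jj].
    by have := lt1 _ _ Jj Ii; lia.
  by have := lt2 _ _ Ik Jj; lia.
pose D := J `\` I; pose E := I `\` J.
have DE x y : x \in D -> y \in E -> x != y.
  rewrite !inE => /andP[xI xJ] /andP[yJ yI].
  by apply: contraNneq xI => ->.
(* The lower part consists of the elements of [J - I] below all of [I - J]. Any other element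
   exceeds some [z] of [I - J], hence, without a pattern [i < j < k], all of them. *)
exists [fset j in D | all (fun i => j < i) (enum_fset E)].
exists [fset j in D | ~~ all (fun i => j < i) (enum_fset E)].
split.
- apply/fsetP => x; rewrite in_fsetU !in_fset !inE /= -andb_orr orbN andbT.
  by rewrite andbC.
- by apply/fdisjointP => x; rewrite !in_fset !inE /= => /andP[-> ->]; rewrite andbF.
- apply/allrelP => x y; rewrite in_fset !inE /= => /andP[_ /allP xE] yE.
  by apply: xE; rewrite /E !inE.
- apply/allrelP => x y xE; rewrite in_fset inE /= => /andP[yD /allPn[z zE yz]].
  have n1 := DE _ _ yD xE; have n2 := DE _ _ yD zE.
  rewrite ltnNge; apply/negP => yx.
  by apply: (H z y x) => //; lia.
Qed.

Lemma weakly_separatedP (I J : {fset nat}) :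
  weakly_separated I J <-> ~ crosses I J /\ ~ crosses J I.
Proof.
split=> [wsIJ|[nIJ nJI]].
  wlog sep : I J wsIJ / surrounds J I => [hw|].
    case: (wsIJ) => sep; first exact: hw.
    by have [] := hw J I _ sep; [case: wsIJ; [right|left]|split].
  by split=> -[a [b [c [d [ab bc cd [Ha Hb Hc Hd]]]]]];
    move/surroundsP: sep => sep; [apply: (sep a b c)|apply: (sep b c d)].
have [sep|nsep] := pselect (surrounds J I); first by left.
right; apply/surroundsP => i j k iJ jI kJ ij jk; apply: nsep.
apply/surroundsP => i' j' k' iI jJ kI ij' jk'.
have neq x y : x \in I `\` J -> y \in J `\` I -> x != y.
  by rewrite !inE => /andP[xJ xI] /andP[yI yJ]; apply: contraNneq xJ => ->.
(* Among [i < j < k] in J-I, I-J, J-I and [i' < j' < k'] in I-J, J-I, I-J,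
   comparing [j] with [j'] exhibits four alternating elements. *)
have njj := neq _ _ jI jJ.
have [jj|jj] := ltnP j j'.
  by apply: nJI; exists i, j, j', k'.
by apply: nIJ; exists i', j', j, k; split=> //; lia.
Qed.

Lemma ws_cross (I J : {fset nat}) (a b c d : nat) :
  weakly_separated I J -> a < b < c -> c < d ->
  a \in I -> a \notin J -> b \in J -> b \notin I ->
  c \in I -> c \notin J -> d \in J -> d \notin I -> False.
Proof.
move=> /weakly_separatedP[nIJ _] /andP[ab bc] cd aI aJ bJ bI cI cJ dJ dI.
by apply: nIJ; exists a, b, c, d; split=> //; rewrite !inE; split; apply/andP.
Qed.

Lemma ws_sym (I J : {fset nat}) : weakly_separated I J -> weakly_separated J I.
Proof. by case; [right|left]. Qed.

Lemma ws_intro (I J : {fset nat}) :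
  (forall a b c d, a < b < c -> c < d ->
    a \in I -> a \notin J -> b \in J -> b \notin I ->
    c \in I -> c \notin J -> d \in J -> d \notin I -> False) ->
  (forall a b c d, a < b < c -> c < d ->
    a \in J -> a \notin I -> b \in I -> b \notin J ->
    c \in J -> c \notin I -> d \in I -> d \notin J -> False) ->
  weakly_separated I J.
Proof.
move=> H1 H2; apply/weakly_separatedP; split=> -[a [b [c [d [ab bc cd []]]]]];
  rewrite !inE => /andP[? ?] /andP[? ?] /andP[? ?] /andP[? ?].
  by apply: (H1 a b c d); rewrite ?ab.
by apply: (H2 a b c d); rewrite ?ab.
Qed.

(** * Triples, and separation from triples containing 1 *)

Lemma in_interval (a b i : nat) : (i \in interval a b) = (a <= i <= b).
Proof. by rewrite /interval !inE /= mem_index_iota ltnS. Qed.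

Lemma ksubset3P (n : nat) (I : {fset nat}) :
  reflect (exists x y z, [/\ 0 < x, x < y, y < z, z <= n & I = [fset x; y; z]])
          (ksubset 3 n I).
Proof.
apply: (iffP andP) => [[/fsubsetP sub /eqP card3]|[x [y [z [x0 xy yz zn ->]]]]].
  have := sort_sorted leq_total (enum_fset I).
  have := fset_uniq I; rewrite -(sort_uniq leq).
  have : size (sort leq I) = 3 by rewrite size_sort.
  have : forall i, (i \in I) = (i \in sort leq I) by move=> i; rewrite mem_sort.
  case: (sort leq I) => [|x [|y [|z [|]]]] // memI _ Hu Hs.
  exists x, y, z.
  have xI : x \in interval 1 n by apply: sub; rewrite memI !inE eqxx.
  have zI : z \in interval 1 n by apply: sub; rewrite memI !inE eqxx !orbT.
  move: Hu Hs xI zI; rewrite !in_interval /= !inE /= => Hu Hs xI zI.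
  split; try lia.
  by apply/fsetP => i; rewrite memI !inE orbA.
split.
  by apply/fsubsetP => i; rewrite in_interval !inE; lia.
by rewrite fsetUC cardfsU1 cardfs2 !inE; apply/eqP; lia.
Qed.

Lemma ws_refl (I : {fset nat}) : weakly_separated I I.
Proof.
by apply: ws_intro => a b c d _ _ Ia nIa; rewrite Ia in nIa.
Qed.

Lemma W_mem (k n : nat) (C : collection) (Y : {fset nat}) :
  W k n C -> ksubset k n Y ->
  (forall I, I \in C -> weakly_separated Y I) -> Y \in C.
Proof.
move=> [[kC wC] maxC] kY wY; rewrite -(maxC (Y |` C)) ?fset1U1 ?fsubsetU1 //.
split=> [I|I J]; rewrite !inE; first by case/orP => [/eqP->|/kC].
case/orP => [/eqP->|IC]; case/orP => [/eqP->|JC].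
- exact: ws_refl.
- exact: wY.
- exact/ws_sym/wY.
- exact: wC.
Qed.

Lemma ksubset_triple (n x y z : nat) :
  ksubset 3 n [fset x; y; z] ->
  [/\ x != y, x != z, y != z & [/\ 0 < x <= n, 0 < y <= n & 0 < z <= n]].
Proof.
case/andP => /fsubsetP sub card3.
have xI : x \in interval 1 n by apply: sub; rewrite !inE eqxx.
have yI : y \in interval 1 n by apply: sub; rewrite !inE eqxx orbT.
have zI : z \in interval 1 n by apply: sub; rewrite !inE eqxx !orbT.
move: card3 xI yI zI; rewrite !in_interval fsetUC cardfsU1 cardfs2 !inE.
by case: eqP; case: eqP; case: eqP => //= *; split => //; apply/eqP; lia.
Qed.

Lemma ksubset_bound (k n : nat) (Y : {fset nat}) (y : nat) :
  ksubset k n Y -> y \in Y -> 0 < y <= n.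
Proof. by case/andP => /fsubsetP sub _ /sub; rewrite in_interval. Qed.

Lemma ksubset3_lt4 (n : nat) (Y : {fset nat}) (a b c d : nat) :
  ksubset 3 n Y -> a < b < c -> c < d -> a \in Y -> b \in Y -> c \in Y ->
  d \in Y -> False.
Proof. by case/ksubset3P => u [v [w [_ uv vw _ ->]]]; rewrite !inE; lia. Qed.

Lemma ksubset3_eq (n : nat) (Y : {fset nat}) (a b c : nat) :
  ksubset 3 n Y -> a < b < c -> a \in Y -> b \in Y -> c \in Y ->
  Y = [fset a; b; c].
Proof.
case/ksubset3P => u [v [w [_ uv vw _ ->]]]; rewrite !inE => abc aY bY cY.
by have [-> -> ->] : [/\ a = u, b = v & c = w] by split; lia.
Qed.

(* As 1 is the least index, it can only be the first term of an alternation,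
   which leaves four patterns. *)
Lemma ws1P (p q : nat) (Y : {fset nat}) :
  1 < p < q -> (forall y, y \in Y -> 0 < y) ->
  weakly_separated [fset 1; p; q] Y <->
  [/\ forall y z, y \in Y -> z \in Y -> 1 \notin Y -> p \notin Y ->
        1 < y < p -> p < z -> z != q -> False,
      forall y z, y \in Y -> z \in Y -> 1 \notin Y -> q \notin Y ->
        1 < y < q -> y != p -> q < z -> False,
      forall y z, y \in Y -> z \in Y -> p \notin Y -> q \notin Y ->
        p < y < q -> q < z -> False &
      forall y z, y \in Y -> z \in Y -> p \notin Y -> q \notin Y ->
        1 < y < p -> p < z < q -> False].
Proof.
move=> pq Y0; split=> [wIY|[HA HB HC HD]].
  split=> y z yY zY n1 n2 *.
  - by apply: (ws_cross (a := 1) (b := y) (c := p) (d := z) wIY) => //;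
      rewrite ?inE; lia.
  - by apply: (ws_cross (a := 1) (b := y) (c := q) (d := z) wIY) => //;
      rewrite ?inE; lia.
  - by apply: (ws_cross (a := p) (b := y) (c := q) (d := z) wIY) => //;
      rewrite ?inE; lia.
  - by apply: (ws_cross (a := y) (b := p) (c := z) (d := q) (ws_sym wIY)) => //;
      rewrite ?inE; lia.
apply: ws_intro => a b c d ab cd.
  rewrite !inE -!orbA => /or3P[] /eqP aE naY bY nbI /or3P[] /eqP cE ncY dY ndI;
    rewrite {}aE {}cE in ab cd naY ncY; try lia.
  - by apply: (HA b d) => //; lia.
  - by apply: (HB b d) => //; lia.
  - by apply: (HC b d) => //; lia.
move=> aY naI bI nbY cY ncI dI ndY; have := Y0 a aY.
move: naI bI nbY ncI dI ndY; rewrite !inE -!orbA.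
move=> naI /or3P[] /eqP bE nbY ncI /or3P[] /eqP dE ndY a0;
  rewrite {}bE {}dE in ab cd nbY ndY; try lia.
by apply: (HD a c) => //; lia.
Qed.

(** * Sets forced into a maximal collection *)

(** Each alternation of [Y] with {1,d,m} yields one with {1,d,n} or {1,m-1,m}, unless [Y] is an
    excluded {1,x,n} or would need four elements. *)
Lemma fill_last (m n d : nat) (Y : {fset nat}) :
  m.+1 = n -> 1 < d < m -> ksubset 3 n Y ->
  weakly_separated [fset 1; d; n] Y ->
  weakly_separated [fset 1; m - 1; m] Y ->
  (forall x, d < x < m -> Y != [fset 1; x; n]) ->
  weakly_separated [fset 1; d; m] Y.
Proof.
move=> mn dm kY wd wP maxd.
have Yn y : y \in Y -> 0 < y <= n by exact: (ksubset_bound kY).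
have Y0 y : y \in Y -> 0 < y by move/Yn; lia.
have [dm1|dm1] := eqVneq d (m - 1); first by rewrite dm1.
have pd : 1 < d < n by lia.
have pm : 1 < m - 1 < m by lia.
move/(ws1P pd Y0): wd => [dA dB dC dD].
move/(ws1P pm Y0): wP => [PA PB PC PD].
(* Such a [Y] has its least element [u] strictly between 1 and [m - 1], so [1 < u < m < n]
   alternates with {1,m-1,m}. *)
have PBn : 1 \notin Y -> m \notin Y -> n \in Y -> False.
  move=> n1 nm nY; case/ksubset3P: (kY) => u [v [w [u0 uv vw wn YE]]].
  have uY : u \in Y by rewrite YE !inE eqxx.
  have u1 : u != 1 by apply: contraNneq n1 => <-.
  have vm : v != m by apply: contraNneq nm => <-; rewrite YE !inE eqxx orbT.
  by apply: (PB u n) => //; lia.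
apply/(ws1P dm Y0); split=> y z yY zY n1 n2; have := Yn z zY.
- move=> zn yd dz zm; have [zE|zE] := eqVneq z n; last by apply: (dA y z).
  have [mY|mY] := boolP (m \in Y); last by apply: PBn => //; rewrite -zE.
  have [m1Y|m1Y] := boolP (m - 1 \in Y); last by apply: (PA y z) => //; lia.
  by apply: (ksubset3_lt4 (a := y) (b := m - 1) (c := m) (d := z) kY) => //; lia.
- by move=> zn ym yd mz; apply: PBn => //; rewrite (_ : n = z) //; lia.
(* Here [z = n]. If 1 is in [Y], then [Y] is {1,y,n} with [d < y < m], which the choice of [d]
   excludes. *)
- move=> zn dy mz; have zE : n = z by lia.
  have [Y1|Y1] := boolP (1 \in Y); last by apply: PBn; rewrite ?zE.
  have := maxd y dy; rewrite (ksubset3_eq kY _ Y1 yY zY) ?zE ?eqxx //; lia.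
- move=> _ yd dz; have [nY|nY] := boolP (n \in Y); last by apply: (dD y z) => //; lia.
  apply: (PBn) => //; apply/negP => Y1.
  by apply: (ksubset3_lt4 (a := 1) (b := y) (c := z) (d := n) kY) => //; lia.
Qed.

Lemma fill_below (m n d b : nat) (Y : {fset nat}) :
  m.+1 = n -> 1 < d < b -> b < m -> ksubset 3 n Y ->
  weakly_separated [fset 1; d; n] Y ->
  weakly_separated [fset 1; b; n] Y ->
  weakly_separated [fset 1; b; m] Y ->
  (forall x, d < x < b -> Y != [fset 1; x; n]) ->
  weakly_separated [fset 1; d; b] Y.
Proof.
move=> mn db bm kY wd wb wm maxd.
have Yn y : y \in Y -> 0 < y <= n by exact: (ksubset_bound kY).
have Y0 y : y \in Y -> 0 < y by move/Yn; lia.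
have pd : 1 < d < n by lia.
have pb : 1 < b < n by lia.
have pm : 1 < b < m by lia.
move/(ws1P pd Y0): wd => [dA dB dC dD].
move/(ws1P pb Y0): wb => [bA bB bC bD].
move/(ws1P pm Y0): wm => [mA mB mC mD].
(* The first clause for {1,b,n} leaves out [z = n]; that case is supplied by the first clause for
   {1,b,m}. *)
have bAn y z : y \in Y -> z \in Y -> 1 \notin Y -> b \notin Y ->
    1 < y < b -> b < z -> False.
  move=> yY zY n1 nb yb bz; have [zn|zn] := eqVneq z n; last by apply: (bA y z).
  by apply: (mA y z) => //; lia.
apply/(ws1P db Y0); split=> y z yY zY n1 n2; have := Yn z zY.
- move=> zn yd dz zb; have [zE|zE] := eqVneq z n; last by apply: (dA y z).
  have [bY|bY] := boolP (b \in Y); last by apply: (bAn y z) => //; lia.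
  apply: (mB y z) => //; try lia; apply/negP => mY.
  by apply: (ksubset3_lt4 (a := y) (b := b) (c := m) (d := z) kY) => //; lia.
- by move=> zn yb yd bz; apply: (bAn y z).
- move=> zn dy bz.
  have [Y1|Y1] := boolP (1 \in Y); last by apply: (bAn y z) => //; lia.
  have YE : Y = [fset 1; y; z] by apply: (ksubset3_eq kY) => //; lia.
  have [zE|zE] := eqVneq z n; first by have := maxd y dy; rewrite YE zE eqxx.
  by apply: (bD y z) => //; try lia; rewrite YE !inE; lia.
- move=> _ yd dz; have [nY|nY] := boolP (n \in Y); last by apply: (dD y z) => //; lia.
  apply: (bAn y n) => //; try lia; apply/negP => Y1.
  by apply: (ksubset3_lt4 (a := 1) (b := y) (c := z) (d := n) kY) => //; lia.
Qed.

(** * Cyclic intervals and the triples containing [n] *)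

(** Each difference has at most one element, whereas an alternation needs two from each. *)
Lemma ws_same_ends (x y p q : nat) :
  weakly_separated [fset p; x; q] [fset p; y; q].
Proof.
have mem u v z : z \in [fset p; u; q] -> z \notin [fset p; v; q] -> z = u.
  by rewrite !inE => zI; rewrite !negb_or => /andP[/andP[zp zy] zq];
    move: zI; rewrite (negPf zp) (negPf zq) orbF => /eqP.
by apply: ws_intro => a b c d ab cd aI naJ _ _ cI ncJ _ _;
  have := mem _ _ _ aI naJ; have := mem _ _ _ cI ncJ; lia.
Qed.

(** {1,n-1,n}, like {1,2,n} and {n-2,n-1,n} below, is an interval in the cyclic order of [[1..n]]:
    of the two arcs between two of its elements, one stays inside the set, so nothing alternates
    with it. *)
Lemma ws_cyclic_1mn (m n : nat) (Y : {fset nat}) :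
  m.+1 = n -> 1 < m -> ksubset 3 n Y -> weakly_separated [fset 1; m; n] Y.
Proof.
move=> mn m1 kY; have Yn y : y \in Y -> 0 < y <= n by exact: (ksubset_bound kY).
have Y0 y : y \in Y -> 0 < y by move/Yn; lia.
have pq : 1 < m < n by lia.
by apply/(ws1P pq Y0); split=> y z yY zY *; have := Yn z zY; lia.
Qed.

Lemma ws_cyclic_12n (n : nat) (Y : {fset nat}) :
  2 < n -> ksubset 3 n Y -> weakly_separated [fset 1; 2; n] Y.
Proof.
move=> n2 kY; have Yn y : y \in Y -> 0 < y <= n by exact: (ksubset_bound kY).
have Y0 y : y \in Y -> 0 < y by move/Yn; lia.
have pq : 1 < 2 < n by lia.
by apply/(ws1P pq Y0); split=> y z yY zY *; have := Yn z zY; lia.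
Qed.

Lemma ws_cyclic_lmn (n : nat) (Y : {fset nat}) :
  2 < n -> ksubset 3 n Y -> weakly_separated [fset n - 2; n - 1; n] Y.
Proof.
move=> n2 kY; have Yn y : y \in Y -> 0 < y <= n by exact: (ksubset_bound kY).
apply: ws_intro => a b c d ab cd.
  move=> aI _ bY nbI cI _ dY ndI; have := Yn d dY.
  by move: aI nbI ndI; rewrite !inE; lia.
move=> aY naI bI _ cY ncI dI _; have := Yn c cY.
by move: bI ncI; rewrite !inE; lia.
Qed.

(** Otherwise [x < y < m < n] alternates. Applied in both directions, this gives the uniqueness of
    [b]. *)
Lemma ends_le (m n x y : nat) :
  m.+1 = n -> 1 < x -> y < m -> weakly_separated [fset 1; x; m] [fset 1; y; n] ->
  y <= x.
Proof.
move=> mn x1 ym wxy; rewrite leqNgt; apply/negP => xy.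
by apply: (ws_cross (a := x) (b := y) (c := m) (d := n) wxy); rewrite ?inE; lia.
Qed.

(** The other shapes alternate with {1,m-1,m}: {u,m,n} along [1 < u < m - 1 < n], and {u,v,n} with
    [1 < u] and [v < m] along [1 < u < m < n]. The bound on [v] is [ends_le]. *)
Lemma shape_last (m n b : nat) (Y : {fset nat}) :
  m.+1 = n -> 1 < b < m -> ksubset 3 n Y -> n \in Y ->
  weakly_separated [fset 1; m - 1; m] Y -> weakly_separated [fset 1; b; m] Y ->
  [\/ Y = [fset 1; m; n], Y = [fset m - 1; m; n] |
      exists2 v, 1 < v <= b & Y = [fset 1; v; n]].
Proof.
move=> mn bm /ksubset3P[u [v [w [u0 uv vw wn ->]]]] nY wP wb.
have wE : w = n by move: nY; rewrite !inE; lia.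
subst w; have [vm|vm] := eqVneq v m.
  subst v; have [->|u1] := eqVneq u 1; first exact: Or31.
  have [->|um] := eqVneq u (m - 1); first exact: Or32.
  by case: (ws_cross (a := 1) (b := u) (c := m - 1) (d := n) wP); rewrite ?inE; lia.
have [u1|u1] := eqVneq u 1; last first.
  by case: (ws_cross (a := 1) (b := u) (c := m) (d := n) wP); rewrite ?inE; lia.
subst u; apply: Or33; exists v => //; rewrite uv /=.
by apply: (ends_le mn _ _ wb); lia.
Qed.

(** * Exchanging [n] and [n - 1] in {1,v,n} preserves separation *)

Lemma ws_merge1 (m n v : nat) (Y : {fset nat}) :
  m.+1 = n -> 1 < v < m -> ksubset 3 n Y -> n \notin Y ->
  weakly_separated [fset 1; v; n] Y -> weakly_separated [fset 1; v; m] Y.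
Proof.
move=> mn vm kY nY; have Yn y : y \in Y -> 0 < y <= m.
  move=> yY; have := ksubset_bound kY yY.
  have : y != n by apply: contraNneq nY => <-.
  lia.
have Y0 y : y \in Y -> 0 < y by move/Yn; lia.
have vn : 1 < v < n by lia.
move/(ws1P vn Y0) => [A B C D].
apply/(ws1P vm Y0); split=> y z yY zY n1 n2 *;
  have ym := Yn y yY; have zm := Yn z zY; try lia.
  by apply: (A y z) => //; lia.
by apply: (D y z) => //; lia.
Qed.

Lemma ws_split1 (m n v b : nat) (Y : {fset nat}) :
  m.+1 = n -> 1 < v <= b -> b < m -> ksubset 3 m Y ->
  (forall s t, 1 < s < t -> t < b -> Y != [fset s; t; m]) ->
  (forall x, 1 < x < b -> Y != [fset 1; x; m]) ->
  weakly_separated [fset 1; v; m] Y -> weakly_separated [fset 1; v; n] Y.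
Proof.
move=> mn vb bm kY noF noE.
have Ym y : y \in Y -> 0 < y <= m by exact: (ksubset_bound kY).
have Y0 y : y \in Y -> 0 < y by move/Ym; lia.
have vm : 1 < v < m by lia.
have vn : 1 < v < n by lia.
move/(ws1P vm Y0) => [A B C D].
(* Only a set {p,q,m} can acquire a new alternation. [noE] excludes [p = 1], [noF] excludes [q < b],
   and for [q >= b] the alternation [1 < p < v < q] is already one with {1,v,m}. *)
have key y : y \in Y -> v \notin Y -> 1 < y < v -> m \in Y -> False.
  move=> yY vY yv mY; case/ksubset3P: (kY) => p [q [r [p0 pq qr rm YE]]].
  have pY : p \in Y by rewrite YE !inE eqxx.
  have qY : q \in Y by rewrite YE !inE eqxx orbT.
  have rE : r = m by move: mY; rewrite YE !inE; lia.
  subst r.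
  have yE : y = p \/ y = q by move: yY; rewrite YE !inE; lia.
  have vq : v != q by apply: contraNneq vY => ->.
  have [p1|p1] := eqVneq p 1.
    have qb : 1 < q < b by lia.
    by have := noE q qb; rewrite YE p1 eqxx.
  have [qb|bq] := ltnP q b.
    have pq' : 1 < p < q by lia.
    by have := noF p q pq' qb; rewrite YE eqxx.
  apply: (A p q) => //; try lia.
  by rewrite YE !inE; lia.
apply/(ws1P vn Y0); split=> y z yY zY n1 n2;
  have ym := Ym y yY; have zm := Ym z zY; try lia.
  move=> yv vz zn; have [zE|zE] := eqVneq z m; last by apply: (A y z).
  by apply: (key y) => //; rewrite -zE.
move=> yv vz; have [mY|mY] := boolP (m \in Y); first by apply: (key y).
apply: (D y z) => //; have : z != m by apply: contraNneq mY => <-.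
lia.
Qed.

(** * The two operations on single triples *)

Lemma merge_last_id (n : nat) (I : {fset nat}) :
  n \notin I -> merge_last n I = I.
Proof. by rewrite /merge_last => /negPf ->. Qed.

Lemma merge_last0 (n : nat) (I : {fset nat}) :
  n \in I -> n - 1 \in I -> merge_last n I = fset0.
Proof. by rewrite /merge_last => -> ->. Qed.

Lemma merge_last1 (n v : nat) :
  1 < v < n - 1 -> merge_last n [fset 1; v; n] = [fset 1; v; n - 1].
Proof.
move=> vn; rewrite /merge_last.
have -> : n \in [fset 1; v; n] by rewrite !inE eqxx !orbT.
have -> : (n - 1 \in [fset 1; v; n]) = false by rewrite !inE; lia.
by apply/fsetP => x; rewrite !inE; lia.
Qed.

Lemma triple_neq0 (x y z : nat) : [fset x; y; z] != fset0.
Proof. by apply/fset0Pn; exists x; rewrite !inE eqxx. Qed.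

Lemma split_last1 (n b y : nat) :
  1 < y <= b -> b < n - 1 ->
  split_last n b [fset 1; y; n - 1] = [fset 1; y; n].
Proof.
move=> yb bn; rewrite /split_last.
have -> : n - 1 \in [fset 1; y; n - 1] by rewrite !inE eqxx !orbT.
have -> : prec ([fset 1; y; n - 1] `\` [fset 1; b; n - 1])
               ([fset 1; b] `\` [fset 1; y; n - 1]).
  by apply/allrelP => p q; rewrite !inE; lia.
by apply/fsetP => x; rewrite !inE; lia.
Qed.

(** If [I] contains [n - 1], the order condition fails at the pair [(v, b)] when [I] is {1,v,n-1}
    with [v > b], and at a pair ending in 1 when 1 is not in [I]. *)
Lemma split_last_id (n b : nat) (I : {fset nat}) :
  1 < b < n - 1 -> ksubset 3 (n - 1) I ->
  (forall y, 1 < y <= b -> I != [fset 1; y; n - 1]) ->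
  split_last n b I = I.
Proof.
move=> bn /ksubset3P[u [v [w [u0 uv vw wn ->]]]] H; rewrite /split_last.
case: andP => // -[mI /allrelP P]; exfalso.
have wE : w = n - 1 by move: mI; rewrite !inE; lia.
subst w.
have [u1|u1] := eqVneq u 1.
  subst u; have [vb|bv] := leqP v b.
    by have := H v; rewrite eqxx uv vb => /(_ isT).
  by have := P v b; rewrite !inE; lia.
have [ub|ub] := eqVneq u b.
  by have := P v 1; rewrite !inE; lia.
by have := P u 1; rewrite !inE; lia.
Qed.

Lemma last_tripleP (b m : nat) (I : {fset nat}) :
  (exists2 y, 1 < y <= b & I = [fset 1; y; m]) \/
  (forall y, 1 < y <= b -> I != [fset 1; y; m]).
Proof.
have [|nex] := pselect (exists2 y, 1 < y <= b & I = [fset 1; y; m]); first by left.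
by right=> y yb; apply/eqP => IE; apply: nex; exists y.
Qed.

(** * Members of contractions and expansions *)

(** Maximality is left out so that the notion passes to separated collections containing [C], as the
    maximality of an expansion requires. *)
Definition pivotal (n b : nat) (C : collection) : Prop :=
  [/\ ws_collection 3 n C, 1 < b < n - 1, [fset 1; n - 2; n - 1] \in C,
      [fset 1; b; n - 1] \in C & [fset 1; b; n] \in C].

(* The last clause is the order condition of [F], given that {1,b,n-1} and
   {s,t,n-1} are weakly separated. *)
Definition expandable (n b : nat) (B : collection) : Prop :=
  [/\ ws_collection 3 (n - 1) B, 1 < b < n - 1, [fset 1; b; n - 1] \in B &
      forall s t, 1 < s < t -> t < b -> [fset s; t; n - 1] \notin B].

Lemma pivotal_last (n b : nat) (C : collection) (Y : {fset nat}) :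
  pivotal n b C -> Y \in C -> n \in Y ->
  [\/ Y = [fset 1; n - 1; n], Y = [fset n - 2; n - 1; n] |
      exists2 v, 1 < v <= b & Y = [fset 1; v; n]].
Proof.
move=> [[kC wC] bn PC mC nC] YC nY.
have e2 : n - 2 = n - 1 - 1 by lia.
have mn : (n - 1).+1 = n by lia.
rewrite e2; apply: (shape_last mn bn (kC _ YC) nY); last exact: wC.
by rewrite -e2; exact: wC.
Qed.

Lemma in_merge_coll (n b : nat) (C : collection) (Z : {fset nat}) :
  pivotal n b C ->
  Z \in merge_coll n C <->
  (Z \in C /\ n \notin Z) \/
  (exists v, [/\ 1 < v <= b, [fset 1; v; n] \in C & Z = [fset 1; v; n - 1]]).
Proof.
move=> pC; have [[kC wC] bn PC mC nC] := pC; rewrite /merge_coll in_fsetD1; split.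
  case/andP => Z0 /imfsetP[I /= IC ZE].
  have [nI|nI] := boolP (n \in I); last first.
    by left; rewrite ZE merge_last_id.
  case: (pivotal_last pC IC nI) => [IE|IE|[v vb IE]].
  - by move: Z0; rewrite ZE merge_last0 ?eqxx // IE !inE eqxx ?orbT.
  - by move: Z0; rewrite ZE merge_last0 ?eqxx // IE !inE eqxx ?orbT.
  right; exists v; split=> //; first by rewrite -IE.
  by rewrite ZE IE merge_last1 //; lia.
case=> [[ZC nZ]|[v [vb vC ->]]].
  apply/andP; split; last by apply/imfsetP; exists Z; rewrite ?merge_last_id.
  by case/ksubset3P: (kC _ ZC) => [u [v [w [_ _ _ _ ->]]]]; exact: triple_neq0.
rewrite triple_neq0 /=; apply/imfsetP; exists [fset 1; v; n] => //=.
by rewrite merge_last1 //; lia.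
Qed.

(** {1,b,n-1} is turned into {1,b,n} and put back by [new_sets]; hence [x < b] in the first clause
    but [y <= b] in the second. *)
Lemma in_expand (n b : nat) (B : collection) (Z : {fset nat}) :
  expandable n b B ->
  Z \in expand n (B, b) <->
  [\/ Z \in B /\ (forall x, 1 < x < b -> Z != [fset 1; x; n - 1]),
      exists y, [/\ 1 < y <= b, [fset 1; y; n - 1] \in B & Z = [fset 1; y; n]],
      Z = [fset 1; n - 1; n] | Z = [fset n - 2; n - 1; n]].
Proof.
move=> [[kB wB] bn bB noF]; rewrite /expand /= in_fsetU; split.
  case/orP => [/imfsetP[I /= IB ->]|]; last first.
    rewrite !inE -!orbA => /or3P[] /eqP ->; [|by apply: Or43|by apply: Or44].
    apply: Or41; split=> // x xb; apply/eqP => /fsetP /(_ b).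
    by rewrite !inE eqxx /=; lia.
  have bn' : b < n - 1 by lia.
  have [[y yb IE]|H] := last_tripleP b (n - 1) I.
    by apply: Or42; exists y; rewrite -IE IE split_last1 // -IE.
  rewrite split_last_id ?kB //; apply: Or41; split=> // x xb.
  by apply: H; lia.
case=> [[ZB ZE]|[y [yb yB ->]]|->|->].
- have [->|Zb] := eqVneq Z [fset 1; b; n - 1]; first by rewrite !inE eqxx orbT.
  apply/orP; left; apply/imfsetP; exists Z => //=.
  rewrite split_last_id ?kB // => y yb; have [->//|yb'] := eqVneq y b.
  by apply: ZE; lia.
- apply/orP; left; apply/imfsetP; exists [fset 1; y; n - 1] => //=.
  by rewrite split_last1 //; lia.
- by rewrite !inE eqxx !orbT.
- by rewrite !inE eqxx !orbT.
Qed.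

(** * Both operations preserve separation and undo each other *)

Lemma pivotal_merge_ws (n b : nat) (C : collection) :
  pivotal n b C -> ws_collection 3 (n - 1) (merge_coll n C).
Proof.
move=> pC; have [[kC wC] bn PC mC nC] := pC.
have mn : (n - 1).+1 = n by lia.
split=> [Z|Y Z].
  case/(in_merge_coll _ pC) => [[ZC nZ]|[v [vb _ ->]]].
    case/ksubset3P: (kC _ ZC) => [u [v [w [u0 uv vw wn ZE]]]].
    apply/ksubset3P; exists u, v, w; split=> //.
    have : w != n by apply: contraNneq nZ => <-; rewrite ZE !inE eqxx !orbT.
    lia.
  by apply/ksubset3P; exists 1, v, (n - 1); split=> //; lia.
have sep I v : I \in C -> n \notin I -> 1 < v <= b -> [fset 1; v; n] \in C ->
    weakly_separated [fset 1; v; n - 1] I.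
  move=> IC nI vb vC; apply: (ws_merge1 mn _ (kC _ IC) nI); first lia.
  exact: wC.
case/(in_merge_coll _ pC) => [[YC nY]|[y [yb yC ->]]];
  case/(in_merge_coll _ pC) => [[ZC nZ]|[z [zb zC ->]]].
- exact: wC.
- exact/ws_sym/sep.
- exact: sep.
- exact: ws_same_ends.
Qed.

Lemma pivotal_expandable (n b : nat) (C : collection) :
  pivotal n b C -> expandable n b (merge_coll n C).
Proof.
move=> pC; have [[kC wC] bn PC mC nC] := pC.
split=> //; first exact: pivotal_merge_ws pC.
  apply/(in_merge_coll _ pC); left; split=> //.
  by rewrite !inE; lia.
move=> s t st tb; apply/negP; case/(in_merge_coll _ pC) => [[stC _]|[v [vb _]]].
  (* {s,t,n-1} alternates with {1,b,n} along [1 < s < b < n - 1]. *)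
  by apply: (ws_cross (a := 1) (b := s) (c := b) (d := n - 1) (wC _ _ nC stC));
    rewrite ?inE; lia.
by move/fsetP/(_ 1); rewrite !inE; lia.
Qed.

(** For maximal [C] the inclusion becomes an equality, the expansion being separated. *)
Lemma pivotal_sub_expand (n b : nat) (C : collection) :
  pivotal n b C -> C `<=` expand n (merge_coll n C, b).
Proof.
move=> pC; have [[kC wC] bn PC mC nC] := pC.
have eC := pivotal_expandable pC.
apply/fsubsetP => Z ZC; apply/(in_expand _ eC).
have [nZ|nZ] := boolP (n \in Z); last first.
  apply: Or41; split; first by apply/(in_merge_coll _ pC); left.
  (* As {1,b,n} is in [C], [ends_le] gives [b <= x]. *)
  move=> x xb; apply/eqP => ZE; have := wC _ _ ZC nC; rewrite ZE => w.
  by have := ends_le _ _ _ w; lia.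
case: (pivotal_last pC ZC nZ) => [->|->|[v vb ZE]].
- exact: Or43.
- exact: Or44.
apply: Or42; exists v; split=> //; apply/(in_merge_coll _ pC).
by right; exists v; rewrite -ZE.
Qed.

Lemma expandable_expand_ws (n b : nat) (B : collection) :
  expandable n b B -> ws_collection 3 n (expand n (B, b)).
Proof.
move=> eB; have [[kB wB] bn bB noF] := eB.
have mn : (n - 1).+1 = n by lia.
have kE Z : Z \in expand n (B, b) -> ksubset 3 n Z.
  case/(in_expand _ eB) => [[ZB _]|[y [yb _ ->]]|->|->].
  - case/ksubset3P: (kB _ ZB) => [u [v [w [u0 uv vw wn ZE]]]].
    by apply/ksubset3P; exists u, v, w; split=> //; lia.
  - by apply/ksubset3P; exists 1, y, n; split=> //; lia.
  - by apply/ksubset3P; exists 1, (n - 1), n; split=> //; lia.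
  - by apply/ksubset3P; exists (n - 2), (n - 1), n; split=> //; lia.
have sep I y : I \in B -> (forall x, 1 < x < b -> I != [fset 1; x; n - 1]) ->
    1 < y <= b -> [fset 1; y; n - 1] \in B -> weakly_separated [fset 1; y; n] I.
  move=> IB noE yb yB; have bn' : b < n - 1 by lia.
  apply: (ws_split1 mn yb bn' (kB _ IB) _ noE); last exact: wB.
  by move=> s t st tb; apply: contraNneq (noF s t st tb) => <-.
have c1 I : I \in expand n (B, b) -> weakly_separated [fset 1; n - 1; n] I.
  by move/kE; apply: ws_cyclic_1mn => //; lia.
have c2 I : I \in expand n (B, b) -> weakly_separated [fset n - 2; n - 1; n] I.
  by move/kE; apply: ws_cyclic_lmn => //; lia.
split=> // Y Z YE ZE.
case/(in_expand _ eB): (YE) => [[YB noY]|[y [yb yB eY]]|->|->];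
  [ | |exact: c1|exact: c2];
  case/(in_expand _ eB): (ZE) => [[ZB noZ]|[z [zb zB eZ]]|->|->];
  try (by apply/ws_sym/c1); try (by apply/ws_sym/c2).
- exact: wB.
- by rewrite eZ; apply/ws_sym/sep.
- by rewrite eY; apply: sep.
- by rewrite eY eZ; apply: ws_same_ends.
Qed.

Lemma expandable_expand_pivotal (n b : nat) (B : collection) :
  expandable n b B -> [fset 1; n - 2; n - 1] \in B ->
  pivotal n b (expand n (B, b)).
Proof.
move=> eB PB; have [[kB wB] bn bB noF] := eB.
have ineq x y : 1 < x < n - 1 -> 1 < y < n - 1 ->
    [fset 1; x; n - 1] = [fset 1; y; n - 1] -> x = y.
  by move=> xn yn /fsetP /(_ x); rewrite !inE; lia.
split=> //; first exact: expandable_expand_ws.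
- apply/(in_expand _ eB); apply: Or41; split=> // x xb; apply/eqP => /ineq; lia.
- apply/(in_expand _ eB); apply: Or41; split=> // x xb; apply/eqP => /ineq; lia.
- by apply/(in_expand _ eB); apply: Or42; exists b; split=> //; lia.
Qed.

Lemma merge_expand (n b : nat) (B : collection) :
  expandable n b B -> [fset 1; n - 2; n - 1] \in B ->
  merge_coll n (expand n (B, b)) = B.
Proof.
move=> eB PB; have [[kB wB] bn bB noF] := eB.
have pE := expandable_expand_pivotal eB PB.
have nB Z : Z \in B -> n \notin Z.
  by move/kB => kZ; apply/negP => /(ksubset_bound kZ); lia.
apply/fsetP => Z; apply/idP/idP.
  case/(in_merge_coll _ pE) => [[/(in_expand _ eB) ZE nZ]|[v [vb vE ->]]].
    case: ZE => [[]//|[y [yb _ ZE]]|ZE|ZE]; move: nZ; rewrite ZE !inE; lia.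
  case/(in_expand _ eB): vE => [[/nB]|[y [yb yB vE]]|vE|vE].
  - by rewrite !inE; lia.
  - suff -> : v = y by [].
    by move/fsetP/(_ v): vE; rewrite !inE; lia.
  - by move/fsetP/(_ (n - 1)): vE; rewrite !inE; lia.
  - by move/fsetP/(_ (n - 1)): vE; rewrite !inE; lia.
move=> ZB; apply/(in_merge_coll _ pE).
have [[y yb ZE]|H] := last_tripleP b (n - 1) Z.
  right; exists y; split=> //.
  by apply/(in_expand _ eB); apply: Or42; exists y; rewrite -ZE.
left; split; last exact: nB.
apply/(in_expand _ eB); apply: Or41; split=> // x xb.
by apply: H; lia.
Qed.

(** * Monotonicity, and maximality of the expansion *)

Lemma merge_collS (n : nat) (C D : collection) :
  C `<=` D -> merge_coll n C `<=` merge_coll n D.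
Proof.
move=> /fsubsetP CD; apply: fsetSD; apply/fsubsetP => Z /imfsetP[I /= IC ->].
by apply/imfsetP; exists I => //=; apply: CD.
Qed.

Lemma expandS (n b : nat) (B D : collection) :
  B `<=` D -> expand n (B, b) `<=` expand n (D, b).
Proof.
move=> /fsubsetP BD; apply: fsetSU; apply/fsubsetP => Z /imfsetP[I /= IB ->].
by apply/imfsetP; exists I => //=; apply: BD.
Qed.

Lemma W_subset_eq (k n : nat) (C D : collection) :
  W k n C -> ws_collection k n D -> C `<=` D -> D = C.
Proof. by case=> _; apply. Qed.

Lemma W_cyclic (n : nat) (C : collection) :
  2 < n -> W 3 n C -> [fset 1; 2; n] \in C /\ [fset 1; n - 1; n] \in C.
Proof.
move=> n2 WC; have [[kC _] _] := WC.
split; apply: (W_mem WC).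
- by apply/ksubset3P; exists 1, 2, n; split.
- by move=> I /kC; apply: ws_cyclic_12n.
- by apply/ksubset3P; exists 1, (n - 1), n; split=> //; lia.
- by move=> I /kC; apply: ws_cyclic_1mn; lia.
Qed.

(** A separated [D] containing the expansion contracts to a separated collection containing [B],
    hence to [B] itself; so [D] lies in the expansion of [B]. *)
Lemma W_expand (n b : nat) (B : collection) :
  expandable n b B -> [fset 1; n - 2; n - 1] \in B -> W 3 (n - 1) B ->
  W 3 n (expand n (B, b)).
Proof.
move=> eB PB WB; split; first exact: expandable_expand_ws.
move=> D wD ED; have [_ bn PE bE nE] := expandable_expand_pivotal eB PB.
have pD : pivotal n b D by split=> //; apply: (fsubsetP ED).
have mD : merge_coll n D = B.
  apply: (W_subset_eq WB); first exact: pivotal_merge_ws pD.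
  by rewrite -{1}(merge_expand eB PB); apply: merge_collS.
by apply/eqP; rewrite eqEfsubset ED andbT -mD; apply: pivotal_sub_expand.
Qed.

(** * Existence and uniqueness of [b] *)

(** The cyclic interval {1,2,n} provides a first candidate. The bound is [n - 1] when the index of
    [C] is constructed, and that index itself in [W_merge]. *)
Lemma max_last (n b : nat) (C : collection) :
  2 < b -> [fset 1; 2; n] \in C ->
  exists d, [/\ 1 < d < b, [fset 1; d; n] \in C &
    forall x, d < x < b -> [fset 1; x; n] \notin C].
Proof.
move=> b2 C2; pose P d := (d < b) && ([fset 1; d; n] \in C).
have exP : exists d, P d by exists 2; rewrite /P b2.
have ubP d : P d -> d <= b by case/andP => /ltnW.
case: (ex_maxnP exP ubP) => d /andP[db dC] maxd; exists d; split=> //.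
  by have := maxd 2; rewrite /P b2 C2 => /(_ isT); lia.
move=> x /andP[dx xb]; apply/negP => xC.
by have := maxd x; rewrite /P xb xC => /(_ isT); lia.
Qed.

Lemma pivotal_exists (n : nat) (C : collection) :
  3 < n -> domC n C -> exists b, pivotal n b C.
Proof.
move=> n3 [WC PC]; have [[kC wC] _] := WC.
have [C2 _] := W_cyclic (ltnW n3) WC.
(* This is where [n >= 4] enters: 2 must be a candidate below [n - 1]. *)
have n2 : 2 < n - 1 by lia.
have [d [dn dC maxd]] := max_last n2 C2.
exists d; split=> //.
apply: (W_mem WC) => [|I IC].
  by apply/ksubset3P; exists 1, d, (n - 1); split=> //; lia.
have mn : (n - 1).+1 = n by lia.
apply: (fill_last mn dn (kC _ IC)); first exact: wC.
- have <- : n - 2 = n - 1 - 1 by lia.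
  exact: wC.
- by move=> x dx; apply: contraNneq (maxd x dx) => <-.
Qed.

Lemma pivotal_inj (n b c : nat) (C : collection) :
  pivotal n b C -> pivotal n c C -> b = c.
Proof.
move=> [[_ wC] bn _ bm bN] [_ cn _ cm cN].
have mn : (n - 1).+1 = n by lia.
apply/eqP; rewrite eqn_leq; apply/andP; split.
  by apply: (ends_le mn _ _ (wC _ _ cm bN)); lia.
by apply: (ends_le mn _ _ (wC _ _ bm cN)); lia.
Qed.

(** The bound [b < n - 1] comes from cardinality: with [b = n - 1] or [b = n], one of the two sets
    would have only two elements. *)
Lemma is_b_indexP (n b : nat) (C : collection) :
  domC n C -> is_b_index n C b <-> pivotal n b C.
Proof.
move=> [[wC _] PC]; split=> [[b1 bm bN]|[_ bn _ bm bN]]; last by split=> //; lia.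
split=> //; have [_ _ bn1 _] := ksubset_triple (wC.1 _ bm).
by have [_ _ bn [_ b_le _]] := ksubset_triple (wC.1 _ bN); lia.
Qed.

Lemma pivotal_b_index (n : nat) (C : collection) :
  3 < n -> domC n C -> pivotal n (b_index n C) C.
Proof.
move=> n3 dC; have [b pb] := pivotal_exists n3 dC.
apply/(is_b_indexP _ dC); rewrite /b_index.
(* An index exists, so the default 0 is not returned. *)
by apply: (@xgetPex _ 0 [set c | is_b_index n C c]%classic); exists b; apply/is_b_indexP.
Qed.

(** * Maximality of the contraction *)

(** One of [s], [t] differs from [d]; calling it [y], the indices [1 < y < b < m] alternate. *)
Lemma not_ws_below (m b d s t : nat) :
  1 < d < b -> b < m -> 1 < s < t -> t < b ->
  weakly_separated [fset 1; d; b] [fset s; t; m] -> False.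
Proof.
move=> db bm st tb wdb.
have [y [y1 yb yd yE]] : exists y, [/\ 1 < y, y < b, y != d & y \in [fset s; t; m]].
  have [sd|sd] := eqVneq s d.
    by exists t; split; rewrite ?inE ?eqxx ?orbT //; lia.
  by exists s; split; rewrite ?inE ?eqxx ?orbT //; lia.
by apply: (ws_cross (a := 1) (b := y) (c := b) (d := m) wdb) => //;
  rewrite ?inE; lia.
Qed.

Lemma W_merge (n b : nat) (C : collection) :
  pivotal n b C -> W 3 n C -> W 3 (n - 1) (merge_coll n C).
Proof.
move=> pC WC; have [[kC wC] bn PC bm bN] := pC.
have mn : (n - 1).+1 = n by lia.
have n2 : 2 < n by lia.
split; first exact: pivotal_merge_ws pC.
move=> D [kD wD] CD; have CDi Z : Z \in C -> n \notin Z -> Z \in D.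
  by move=> ZC nZ; apply: (fsubsetP CD); apply/(in_merge_coll _ pC); left.
have eD : expandable n b D.
  split=> //; first by apply: CDi => //; rewrite !inE; lia.
  move=> s t st tb; apply/negP => stD.
  have b2 : 2 < b by lia.
  have [d [db dC maxd]] := max_last b2 (W_cyclic n2 WC).1.
  have dbC : [fset 1; d; b] \in C.
    apply: (W_mem WC) => [|I IC].
      by apply/ksubset3P; exists 1, d, b; split=> //; lia.
    have bn' : b < n - 1 by lia.
    apply: (fill_below mn db bn' (kC _ IC)); try exact: wC.
    by move=> x dx; apply: contraNneq (maxd x dx) => <-.
  have {dbC}dbD : [fset 1; d; b] \in D by apply: CDi => //; rewrite !inE; lia.
  by apply: (not_ws_below _ _ st tb (wD _ _ dbD stD)); lia.
have PD : [fset 1; n - 2; n - 1] \in D by apply: CDi => //; rewrite !inE; lia.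
(* [D] is the contraction of its expansion, which contains the expansion of C', hence [C], and so
   equals [C] by maximality. *)
rewrite -{1}(merge_expand eD PD) (W_subset_eq WC (expandable_expand_ws eD)) //.
exact: fsubset_trans (pivotal_sub_expand pC) (expandS n b CD).
Qed.

(** * The target set and the bijection *)

Lemma codCP (n b : nat) (B : collection) :
  3 < n -> codC n (B, b) <-> W 3 (n - 1) B /\ expandable n b B.
Proof.
move=> n3; split=> [[/= WB bn [_ bB bF]]|[WB [[kB wB] bn bB noF]]].
  rewrite in_interval in bn; split=> //; split=> //; [by case: WB|lia|].
  move=> s t /andP[s1 st] tb; apply/negP => stB.
  have tn : t < n - 1 by lia.
  (* The order condition at the pair [(b, s)] would give [b < s]. *)
  have /allrelP/(_ b s) := bF s t s1 st tn stB.
  by rewrite !inE; lia.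
have bi m : b < m -> b \in interval 2 (m - 1).
  by move=> bm; rewrite in_interval; lia.
split=> //=; first by rewrite in_interval; lia.
split=> //; first by apply: bi; lia.
move=> s t s1 st tn stB; apply/allrelP => x y; rewrite !inE => xE yE.
have bt : b <= t.
  rewrite leqNgt; apply/negP => tb; move: stB; apply/negP; apply: noF => //.
  by rewrite s1.
have [x1|x1] := eqVneq x 1; first lia.
have xb : x = b by lia.
have bt' : b < t by lia.
have [bs|sb] := ltnP b s; first lia.
(* There remains [s < b < t], where [1 < s < b < t] alternates between {1,b,n-1} and {s,t,n-1}. *)
by case: (ws_cross (a := 1) (b := s) (c := b) (d := t) (wB _ _ bB stB));
  rewrite ?inE; lia.
Qed.

(** With [N = n - 1] this is the cyclic interval {1,N-1,N}, a member of every maximal collection. *)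
Lemma W_12m (n : nat) (B : collection) :
  3 < n -> W 3 (n - 1) B -> [fset 1; n - 2; n - 1] \in B.
Proof.
move=> n3 WB; have -> : n - 2 = n - 1 - 1 by lia.
by have [] := W_cyclic _ WB; lia.
Qed.

Lemma set_bij_cancel (T U : Type) (A : set T) (B : set U) (f : T -> U) (g : U -> T) :
  (forall x, A x -> B (f x)) -> (forall y, B y -> A (g y)) ->
  (forall x, A x -> g (f x) = x) -> (forall y, B y -> f (g y) = y) ->
  set_bij A B f.
Proof.
move=> fAB gBA fK gK; split=> [x|x y /set_mem Ax /set_mem Ay fxy|y By].
- exact: fAB.
- by rewrite -(fK x Ax) fxy fK.
- by exists (g y); [exact: gBA|exact: gK].
Qed.

Theorem theorem6 (n : nat) (n_ge4 : 4 <= n) :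
  (* b_C is well defined *)
  (forall C, domC n C -> unique (is_b_index n C) (b_index n C)) /\
  (* C |-> (C', b_C) is a bijection *)
  set_bij (domC n) (codC n) (contract n) /\
  (* the union defining the inverse is disjoint *)
  (forall B b, codC n (B, b) -> [disjoint split_coll n B b & new_sets n b]%fset) /\
  (* (B, b) |-> \hat B_b is the inverse bijection *)
  set_bij (codC n) (domC n) (expand n) /\
  {in domC n, cancel (contract n) (expand n)} /\
  {in codC n, cancel (expand n) (contract n)}.
Proof.
have domC_codC C : domC n C -> codC n (contract n C).
  move=> dC; have pC := pivotal_b_index n_ge4 dC; apply/codCP => //.
  by split; [apply: W_merge pC _; case: dC|apply: pivotal_expandable].
have codC_domC p : codC n p -> domC n (expand n p).
  case: p => B b /(codCP _ _ n_ge4)[WB eB]; have PB := W_12m n_ge4 WB.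
  by split; [exact: W_expand|have [] := expandable_expand_pivotal eB PB].
have contractK C : domC n C -> expand n (contract n C) = C.
  move=> dC; have pC := pivotal_b_index n_ge4 dC; have [WC _] := dC.
  apply: (W_subset_eq WC); last exact: pivotal_sub_expand.
  exact: (expandable_expand_ws (pivotal_expandable pC)).
have expandK p : codC n p -> contract n (expand n p) = p.
  case: p => B b cp; have /(codCP _ _ n_ge4)[WB eB] := cp.
  have PB := W_12m n_ge4 WB; rewrite /contract merge_expand //; congr pair.
  (* Both [b] and the index computed from the expansion are pivotal for it, so they agree. *)
  apply: (@pivotal_inj n _ _ (expand n (B, b))).
    exact/pivotal_b_index/codC_domC.
  exact: expandable_expand_pivotal.
split.
  move=> C dC; split; first by apply/(is_b_indexP _ dC)/pivotal_b_index.
  move=> c /(is_b_indexP _ dC); apply: pivotal_inj.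
  exact: pivotal_b_index.
split; first exact: (set_bij_cancel domC_codC codC_domC contractK expandK).
split.
  move=> B b /(codCP _ _ n_ge4)[_ [[kB _] bn _ _]].
  apply/fdisjointP => Z /imfsetP[I /= IB ->].
  have kI := kB _ IB; have nI : n \notin I.
    by apply/negP => /(ksubset_bound kI); lia.
  (* A changed set {1,y,n} lacks [n - 1], which all new sets contain. An unchanged set lacks [n], so
     it could only be {1,b,n-1}, which is always changed. *)
  have [[y yb IE]|H] := last_tripleP b (n - 1) I.
    rewrite IE split_last1 //; last lia.
    rewrite !inE -!orbA; apply/negP => /or3P[] /eqP/fsetP ZE.
    - by move: (ZE n); rewrite !inE; lia.
    - by move: (ZE (n - 1)); rewrite !inE; lia.
    - by move: (ZE (n - 1)); rewrite !inE; lia.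
  rewrite split_last_id // !inE -!orbA; apply/negP => /or3P[] /eqP IE.
  - by have := H b; rewrite IE eqxx => /(_ _)/negP; case; lia.
  - by move: nI; rewrite IE !inE; lia.
  - by move: nI; rewrite IE !inE; lia.
split; first exact: (set_bij_cancel codC_domC domC_codC expandK contractK).
by split=> [C /set_mem|p /set_mem]; [exact: contractK|exact: expandK].
Qed.
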